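(* Let $\Omega\subset\mathbb H$ be a connected bounded open set and let $p,p'\in\mathbb S^2$ with $p\neq\pm p'$. Then every $f\in Hol_p(\Omega,\mathbb H)\cap Hol_{p'}(\Omega,\mathbb H)$ is an affine map.
   Context: Identify $\mathbb H\simeq\mathbb R^4$ via $q=x_0+ix_1+jx_2+kx_3$. $\mathbb S^2=\{p\in\mathbb H: p^2=-1\}$ is the sphere of unit imaginary quaternions $p=p_1i+p_2j+p_3k$. On each tangent space $T_x\mathbb H\simeq\mathbb H$, $J_1$ and $J_2$ are left multiplication by $i$ and $j$, and $J_3=-J_1J_2$ (so $J_3$ is left multiplication by $-k$). For $p\in\mathbb S^2$ put $J_p=p_1J_1+p_2J_2+p_3J_3$, and let $L_p$ be left multiplication by $p$ on the target $\mathbb H$. $Hol_p(\Omega,\mathbb H)$ is the set of ($C^1$) maps $f:\Omega\to\mathbb H$ that are holomorphic from $(\Omega,J_p)$ to $(\mathbb H,L_p)$, i.e. such that $df+L_p\circ df\circ J_p=0$ on $\Omega$. ''Affine'' means the restriction to $\Omega$ of a real-affine map $\mathbb R^4\to\mathbb R^4$ (a real-linear map plus a constant). *)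

(* Defs.v *)
From HB Require Import structures.
From mathcomp Require Import all_boot all_order all_algebra.
From mathcomp Require Import all_classical all_reals all_analysis.
Import Order.TTheory GRing.Theory Num.Theory.
Import numFieldNormedType.Exports.

Set Implicit Arguments.
Unset Strict Implicit.
Unset Printing Implicit Defensive.

Local Open Scope classical_set_scope.
Local Open Scope ring_scope.

(* [x 0 m] is the coordinate x_m of x = x_0 + i x_1 + j x_2 + k x_3.  All norms
   on R^4 being equivalent, the library's sup norm on row vectors induces the
   usual topology, bounded sets and differentials. *)
Notation quat R := 'rV[R]_4.

Definition mkquat (R : realType) (a b c d : R) : quat R :=
  \row_(m < 4) [:: a; b; c; d]`_m.

Definition qone (R : realType) : quat R := mkquat 1 0 0 0.
Definition qi (R : realType) : quat R := mkquat 0 1 0 0.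
Definition qj (R : realType) : quat R := mkquat 0 0 1 0.
Definition qk (R : realType) : quat R := mkquat 0 0 0 1.

(* Hamilton product. *)
Definition qmul (R : realType) (x y : quat R) : quat R :=
  mkquat
    (x 0 0 * y 0 0 - x 0 1 * y 0 1 - x 0 2 * y 0 2 - x 0 3 * y 0 3)
    (x 0 0 * y 0 1 + x 0 1 * y 0 0 + x 0 2 * y 0 3 - x 0 3 * y 0 2)
    (x 0 0 * y 0 2 - x 0 1 * y 0 3 + x 0 2 * y 0 0 + x 0 3 * y 0 1)
    (x 0 0 * y 0 3 + x 0 1 * y 0 2 - x 0 2 * y 0 1 + x 0 3 * y 0 0).

Definition sphere2 (R : realType) : set (quat R) :=
  [set p | qmul p p = - qone R].

Definition J1 (R : realType) (v : quat R) : quat R := qmul (qi R) v.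
Definition J2 (R : realType) (v : quat R) : quat R := qmul (qj R) v.
(* The sign makes [J3] left multiplication by -k, see [J3E]. *)
Definition J3 (R : realType) (v : quat R) : quat R := - J1 (J2 v).

Definition Jp (R : realType) (p v : quat R) : quat R :=
  p 0 1 *: J1 v + p 0 2 *: J2 v + p 0 3 *: J3 v.

(* A map Omega -> R^4 is represented by a total function; since Omega is open,
   differentials at points of Omega only depend on its values on Omega. *)
Definition C1_on (R : realType) (Omega : set (quat R)) (f : quat R -> quat R) :=
  forall x, Omega x ->
    differentiable f x /\ {for x, continuous (jacobian f)}.

Definition Hol (R : realType) (p : quat R) (Omega : set (quat R)) :
    set (quat R -> quat R) :=
  [set f | C1_on Omega f /\
    forall x, Omega x ->
      forall v, 'd f x v + qmul p ('d f x (Jp p v)) = 0].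

Definition affine_on (R : realType) (Omega : set (quat R))
    (f : quat R -> quat R) :=
  exists (A : {linear quat R -> quat R}) (b : quat R),
    forall x, Omega x -> f x = A x + b.

Lemma J3E (R : realType) (v : quat R) : J3 v = qmul (- qk R) v.
Proof.
apply/rowP => m; rewrite /J3 /J1 /J2 /qi /qj /qk /qmul /mkquat !mxE /=.
by case: m => [[|[|[|[|m]]]] hm] //=;
  rewrite !(mul0r, mul1r, oppr0, subr0, addr0, add0r, sub0r, mulNr, opprK).
Qed.

(* Main.v *)
Require Import Defs.
From HB Require Import structures.
From mathcomp Require Import all_boot all_order all_algebra.
From mathcomp Require Import all_classical all_reals all_analysis.
From mathcomp Require Import ring lra.
Import Order.TTheory GRing.Theory Num.Theory.
Import numFieldNormedType.Exports.

(* Holomorphy for p and p' means D_(J_p v) f = p D_v f and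
   D_(J_p' v) f = p' D_v f.  If f were C^2, exchanging the two derivatives
   would give (p p' - p' p) D_v D_v f = 0, hence D_v D_v f = 0 because p p' - p' p is
   invertible.  For f of class C^1 the argument is applied instead to
   F y = \int_0^1 f (y + t v) dt: its derivative along J_p v is
   \int_0^1 p D_v f (y + t v) dt = p (f (y + v) - f y), which is again C^1.
   This yields D_v f (x + v) = D_v f x whenever x and x + v lie in a common ball
   of Omega, so f is affine on balls, and on Omega by connectedness. *)

Set Implicit Arguments.
Unset Strict Implicit.
Unset Printing Implicit Defensive.

Local Open Scope classical_set_scope.
Local Open Scope ring_scope.

(** * Lines and segments in a normed space *)

(** Both sides have the same difference quotient. This is the bridge by which one-variable calculus
    (mean value theorem, integrals) applies to directional derivatives. *)
Lemma is_derive_lineP (R : realType) (V W : normedModType R) (f : V -> W)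
    (y w : V) (d : W) (s : R) :
  is_derive (y + s *: w) w f d <-> is_derive s 1 (fun t => f (y + t *: w)) d.
Proof.
have E : (fun h : R => h^-1 *: (((fun t => f (y + t *: w)) \o shift s) (h *: 1)
      - f (y + s *: w))) =
    (fun h => h^-1 *: ((f \o shift (y + s *: w)) (h *: w) - f (y + s *: w))).
  by apply/funext => h /=; rewrite [h *: 1]mulr1 scalerDl addrCA.
by split=> -[df <-]; split; move: df; rewrite /derivable /derive E.
Qed.

Lemma ball_segment (R : realType) (V : normedModType R) (c x v : V) (r t : R) :
  ball c r x -> ball c r (x + v) -> 0 <= t <= 1 -> ball c r (x + t *: v).
Proof.
rewrite -ball_normE /= => h0 h1 /andP[t0 t1].
have -> : c - (x + t *: v) = (1 - t) *: (c - x) + t *: (c - (x + v)).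
  by rewrite !opprD !addrA (scalerBr _ (c - x)) scalerBl scale1r addrA subrK.
(* The strict bound below comes from the endpoint [x + v] with weight [t], so it needs [t]
   nonzero. *)
have [->|tn0] := eqVneq t 0; first by rewrite subr0 scale1r scale0r addr0.
apply: le_lt_trans (ler_normD _ _) _; rewrite !normrZ.
rewrite (ger0_norm t0) ger0_norm ?subr_ge0//.
have : t * `|c - (x + v)| < t * r by rewrite ltr_pM2l// lt_def tn0.
have : (1 - t) * `|c - x| <= (1 - t) * r by rewrite ler_wpM2l ?subr_ge0// ltW.
lra.
Qed.

Lemma line_continuous (R : realType) (V : normedModType R) (x w : V) :
  continuous (fun s : R => x + s *: w).
Proof.
by move=> s; apply: cvgD; [exact: cvg_cst|apply: cvgZr_tmp; exact: cvg_id].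
Qed.

Lemma near_line (R : realType) (V : normedModType R) (A : set V) (x w : V) :
  open A -> A x -> \forall s \near (0 : R), A (x + s *: w).
Proof.
move=> oA Ax; apply: (line_continuous (x := x) (w := w)).
by rewrite scale0r addr0; exact: open_nbhs_nbhs.
Qed.

(** * Differentiating an integral along a segment *)

Section integral_along_segment.
Context {R : realType} {V : normedModType R}.
Variables (phi psi : V -> R) (c : V) (r M : R) (v w : V).
Hypothesis dphi : forall y, ball c r y -> differentiable phi y.
Hypothesis dpsi : forall y, ball c r y -> differentiable psi y.
Hypothesis phi_psi : forall y, ball c r y -> 'D_w phi y = 'D_v psi y.
Hypothesis cphi : forall y, ball c r y -> {for y, continuous ('D_w phi)}.
Hypothesis phi_le : forall y, ball c r y -> `|'D_w phi y| <= M.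

(** Differentiating under the integral sign, with the constant [M] as dominating function, gives the
    integral of ['D_w phi] along the segment. Since ['D_w phi] is ['D_v psi], this integrand is the
    derivative of [psi (x + t *: v)] in [t], and the fundamental theorem of calculus evaluates
    it. *)
Lemma is_derive_segment_integral (x : V) : ball c r x -> ball c r (x + v) ->
  is_derive x w
    (fun y => \int[@lebesgue_measure R]_(t in `[0, 1]) phi (y + t *: v))
    (psi (x + v) - psi x).
Proof.
move=> xB xvB.
pose k (s t : R) : R := phi ((x + t *: v) + s *: w).
(* A small translation along [w] keeps the whole segment in the ball: by convexity it suffices to
   control its two endpoints. *)
have [d d0 dB] : exists2 d : R, 0 < d & forall s t : R,
    s \in `]-d, d[ -> t \in `[0, 1] -> ball c r ((x + t *: v) + s *: w).
  have : \forall s \near (0 : R), ball c r (x + s *: w) /\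
      ball c r (x + v + s *: w).
    apply: filterI; apply: near_line => //; exact: ball_open.
  move=> /nbhs_ballP[d /= d0 dB]; exists d => // s t sd t01.
  have /dB[h0 h1] : ball 0 d s by rewrite ball_itv/= sub0r add0r.
  by rewrite addrAC; apply: ball_segment; rewrite 1?addrAC // addrAC.
have derk (s t : R) : s \in `]-d, d[ -> t \in `[0, 1] ->
    is_derive s 1 (k ^~ t) ('D_w phi ((x + t *: v) + s *: w)).
  move=> sd t01; apply/(is_derive_lineP phi); apply: derivableP.
  by apply: diff_derivable; apply: dphi; exact: dB.
have cont01 (g : V -> R) (s : R) : s \in `]-d, d[ ->
    (forall y, ball c r y -> {for y, continuous g}) ->
    {within `[0, 1], continuous (fun t => g ((x + t *: v) + s *: w))}.
  move=> sd cg; apply: continuous_in_subspaceT => t /[!inE] t01.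
  have cl : continuous (fun t : R => x + t *: v + s *: w).
    rewrite (_ : (fun _ => _) = fun t : R => (x + s *: w) + t *: v).
      exact: line_continuous.
    by apply/funext => u; rewrite addrAC.
  exact: (continuous_comp (cl t) (cg _ (dB _ _ sd t01))).
have d00 : 0 \in `](- d), d[ by rewrite in_itv /= oppr_lt0 d0.
have cont0 (g : V -> R) : (forall y, ball c r y -> {for y, continuous g}) ->
    {within `[0, 1], continuous (fun t => g (x + t *: v))}.
  move=> /(cont01 _ _ d00).
  by under [X in continuous X -> _]eq_fun do rewrite scale0r addr0.
have FTC : \int[@lebesgue_measure R]_(t in `[0, 1]) 'D_w phi (x + t *: v) =
    psi (x + v) - psi x.
  have dpsix (t : R) : t \in `[0, 1] ->
      is_derive (t : R) 1 (fun t => psi (x + t *: v)) ('D_w phi (x + t *: v)).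
    rewrite in_itv => t01; apply/(is_derive_lineP psi).
    have tB : ball c r (x + t *: v) by exact: ball_segment.
    by rewrite phi_psi //; apply/derivableP/diff_derivable/dpsi.
  rewrite /Rintegral (@continuous_FTC2 _ _ (fun t => psi (x + t *: v))) //=.
  - by rewrite scale1r scale0r addr0.
  - exact: (cont0 ('D_w phi) cphi).
  - have /continuous_within_itvP : {within `[0, 1],
        continuous (fun t => psi (x + t *: v))}.
      by apply: cont0 => y yB; exact/differentiable_continuous/dpsi.
    move=> /(_ ltr01)[_ h0 h1]; split => // t t01.
    by have [] := dpsix t (subset_itv_oo_cc t01).
  - by move=> t /subset_itv_oo_cc/dpsix[_]; rewrite derive1E.
have pk (s t : R) : s \in `](- d), d[ -> t \in `[0, 1] ->
    partial1of2 k s t = 'D_w phi (x + t *: v + s *: w).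
  by move=> sd t01; rewrite partial1of2E; have [] := derk _ _ sd t01.
have mu01 (g : R -> R) : {within `[0, 1], continuous g} ->
    (@lebesgue_measure R).-integrable `[0, 1] (EFin \o g).
  by apply: continuous_compact_integrable; exact: segment_compact.
have M0 : 0 <= M by rewrite (le_trans _ (phi_le xB)).
(* Writing the base point as [x + 0 *: w] turns the goal into a derivative in [s] at 0. *)
rewrite -FTC -[x in is_derive x]addr0 -(scale0r w); apply/is_derive_lineP.
rewrite (_ : (fun _ => _) =
    fun s => \int[@lebesgue_measure R]_(t in `[0, 1]) k s t); last first.
  by apply/funext => s; apply: eq_Rintegral => t _; rewrite /k addrAC.
have -> : \int[@lebesgue_measure R]_(t in `[0, 1]) 'D_w phi (x + t *: v) =
    \int[@lebesgue_measure R]_(t in `[0, 1]) partial1of2 k 0 t.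
  apply: eq_Rintegral => t /[!inE] t01.
  by rewrite pk // scale0r addr0.
have intk s : `](- d), d[%classic s ->
    (@lebesgue_measure R).-integrable `[0, 1] (EFin \o k s).
  move=> sd; apply/mu01/cont01 => // y yB.
  exact/differentiable_continuous/dphi.
have derk1 s t : `](- d), d[%classic s -> `[0, 1]%classic t ->
    derivable (k ^~ t) s 1.
  by move=> sd t01; have [] := derk s t sd t01.
have leM s t : `](- d), d[%classic s -> `[0, 1]%classic t ->
    `|partial1of2 k s t| <= M.
  by move=> sd t01; rewrite pk //; exact/phi_le/dB.
have intM : (@lebesgue_measure R).-integrable `[0, 1] (EFin \o fun=> M).
  by apply/mu01/continuous_subspaceT => ?; exact: cvg_cst.
split.
  exact: (derivable_under_integral _ d00 intk derk1 (fun=> M0) intM leM).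
rewrite -derive1E.
exact: (differentiation_under_integral _ d00 intk derk1 (fun=> M0) intM leM).
Qed.

End integral_along_segment.

(** * Symmetry of second derivatives *)

Lemma differentiable_near (R : realType) (V W : normedModType R) (P : V -> W)
    (x : V) (e : R) : differentiable P x -> 0 < e ->
  \forall z \near 0, `|P (x + z) - P x - 'd P x z| <= e * `|z|.
Proof.
move=> /diff_locally/eqaddoP H e0; have := H _ e0; apply: filterS => z /=.
by rewrite !fctE /= opprD addrA (addrC z).
Qed.

(** The mean value theorem along [u] turns the second difference into [h] times a difference of two
    values of [P]. Expanding both to first order at [x], the ['D_u P x] terms cancel and
    [h * 'D_w P x] remains. *)
Lemma second_difference (R : realType) (V : normedModType R) (F P : V -> R)
    (x u w : V) (e : R) :
  (\forall y \near x, is_derive y u F (P y)) -> differentiable P x -> 0 < e ->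
  \forall h \near 0^'+,
    `|F (x + h *: u + h *: w) - F (x + h *: u) - F (x + h *: w) + F x
      - h ^+ 2 * 'D_w P x| <= e * h ^+ 2.
Proof.
move=> /nbhs_ballP[d1 /= d10 dF] dP e0.
(* [h * C] bounds every displacement used below; the summand 1 keeps [C] positive. With [e1], each
   expansion of [P] has error at most [e / 2 * h], and two of them are used. *)
pose C := `|u| + `|w| + 1.
have C0 : 0 < C by rewrite ltr_wpDl// addr_ge0.
pose e1 := e / (2 * C).
have e10 : 0 < e1 by rewrite divr_gt0// mulr_gt0.
have /nbhs_ballP[d2 /= d20 Pd2] := differentiable_near dP e10.
near=> h.
have h0 : 0 < h by [].
have hC : h * C < Num.min d1 d2.
  rewrite -ltr_pdivlMr//; near: h; apply: nbhs_right_lt.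
  by rewrite divr_gt0// lt_min d10.
move: hC; rewrite lt_min => /andP[hd1 hd2].
have le_hC (a b : R) : 0 <= a <= h -> 0 <= b <= h ->
    `|b *: w + a *: u| <= h * C.
  move=> /andP[a0 ah] /andP[b0 bh]; apply: le_trans (ler_normD _ _) _.
  rewrite !normrZ !ger0_norm// /C.
  have := ler_wpM2r (normr_ge0 u) ah; have := ler_wpM2r (normr_ge0 w) bh.
  lra.
have inB (a b : R) : 0 <= a <= h -> 0 <= b <= h ->
    ball x d1 (x + b *: w + a *: u).
  move=> ah bh; rewrite -ball_normE /= -addrA opprD addNKr normrN.
  exact: le_lt_trans (le_hC _ _ ah bh) hd1.
have PE (a b : R) : 0 <= a <= h -> 0 <= b <= h ->
    `|P (x + b *: w + a *: u) - P x - (b * 'D_w P x + a * 'D_u P x)|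
    <= e / 2 * h.
  move=> ah bh; have lehC := le_hC _ _ ah bh.
  have /Pd2 : ball 0 d2 (b *: w + a *: u).
    by rewrite -ball_normE /= sub0r normrN (le_lt_trans lehC).
  rewrite addrA linearD !linearZ /= !deriveE// => /le_trans; apply.
  have -> : e / 2 * h = e1 * (h * C) by rewrite /e1; field; lra.
  by rewrite ler_wpM2l// ltW.
(* The second difference is [phi h - phi 0]. *)
pose phi s := F (x + h *: w + s *: u) - F (x + s *: u).
have hh : 0 <= h <= h by rewrite lexx ltW.
have h00 : 0 <= (0 : R) <= h by rewrite lexx ltW.
have dphi s : 0 <= s <= h ->
    is_derive s 1 phi (P (x + h *: w + s *: u) - P (x + s *: u)).
  move=> sh; apply: is_deriveB; apply/(is_derive_lineP F); apply: dF.
    exact: inB.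
  by have := inB s 0 sh h00; rewrite scale0r addr0.
have [s sh] : exists2 s, s \in `[0, h] & phi h - phi 0 =
   (P (x + h *: w + s *: u) - P (x + s *: u)) * (h - 0).
  apply: MVT_segment; first exact: ltW.
    by move=> s sh; apply: dphi; exact: (subset_itv_oo_cc sh).
  apply: derivable_within_continuous => s sh.
  by have [] := dphi _ sh.
rewrite /phi !scale0r !addr0 subr0 => E.
have -> : F (x + h *: u + h *: w) - F (x + h *: u) - F (x + h *: w) + F x =
   (P (x + h *: w + s *: u) - P (x + s *: u)) * h.
  by rewrite -E (addrAC x); ring.
have {}sh : 0 <= s <= h by [].
have := PE _ _ sh hh; have := PE s 0 sh h00.
rewrite scale0r addr0 mul0r add0r.
set p1 := P _; set p2 := P _; set p3 := P _ => H1 H2.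
have -> : (p3 - p1) * h - h ^+ 2 * 'D_w P x =
   ((p3 - p2 - (h * 'D_w P x + s * 'D_u P x)) - (p1 - p2 - s * 'D_u P x)) * h.
  by ring.
rewrite normrM (gtr0_norm h0) expr2 mulrA ler_pM2r//.
apply: le_trans (ler_normB _ _) _.
lra.
Unshelve. all: by end_near. Qed.

(** The second difference of [F] is symmetric in [u] and [w], and both [h ^+ 2 * 'D_w P x] and
    [h ^+ 2 * 'D_u Q x] approximate it to within [e / 2 * h ^+ 2]. *)
Lemma derive_swap (R : realType) (V : normedModType R) (F P Q : V -> R)
    (x u w : V) :
  (\forall y \near x, is_derive y u F (P y)) ->
  (\forall y \near x, is_derive y w F (Q y)) ->
  differentiable P x -> differentiable Q x ->
  'D_w P x = 'D_u Q x.
Proof.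
move=> FP FQ dP dQ; apply/eqP; rewrite -subr_eq0 -normr_le0.
apply/ler_addgt0Pl => e e0; rewrite addr0.
have e20 : 0 < e / 2 by rewrite divr_gt0.
near (0 : R)^'+ => h.
have h0 : 0 < h by [].
have : `|F (x + h *: u + h *: w) - F (x + h *: u) - F (x + h *: w) + F x
      - h ^+ 2 * 'D_w P x| <= e / 2 * h ^+ 2.
  by near: h; exact: second_difference.
have : `|F (x + h *: w + h *: u) - F (x + h *: w) - F (x + h *: u) + F x
      - h ^+ 2 * 'D_u Q x| <= e / 2 * h ^+ 2.
  by near: h; exact: second_difference.
rewrite (addrAC x).
set a := F _; set b := F _; set c := F _; set d := F _ => H1 H2.
rewrite -(ler_pM2r (exprn_gt0 2 h0)) -[X in _ * X](gtr0_norm (exprn_gt0 2 h0)).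
rewrite -normrM.
have -> : ('D_w P x - 'D_u Q x) * h ^+ 2 = 
  (a - b - c + d - h ^+ 2 * 'D_u Q x) - (a - c - b + d - h ^+ 2 * 'D_w P x).
  by ring.
apply: le_trans (ler_normB _ _) _.
lra.
Unshelve. all: by end_near. Qed.

(** * Derivatives under linear maps, translations and coordinates *)

(** The source is finite-dimensional: expanded in the basis of the [delta_mx i j], [g] is a finite
    sum of coordinates times constant vectors. *)
Lemma linear_mx_continuous (R : realType) m n (W : normedModType R)
    (g : {linear 'M[R]_(m, n) -> W}) : continuous g.
Proof.
move=> a; apply: differentiable_continuous.
rewrite (_ : (g : _ -> _) = \sum_(i < m) \sum_(j < n)
    (fun a : 'M[R]_(m, n) => a i j *: g (delta_mx i j))).
  apply: differentiable_sum => i; apply: differentiable_sum => j.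
  exact/differentiableZl/differentiable_coord.
apply/funext => z; rewrite fct_sumE {1}(matrix_sum_delta z) linear_sum.
apply: eq_bigr => i _; rewrite fct_sumE linear_sum.
by apply: eq_bigr => j _; rewrite linearZ.
Qed.

Lemma differentiable_shift (R : realType) (V W : normedModType R) (f : V -> W)
    (x v : V) :
  differentiable f (x + v) -> differentiable (fun y => f (y + v)) x.
Proof.
move=> df; apply: (differentiable_comp (f := fun y => y + v)) => //.
Qed.

Lemma derive_shiftr (R : realType) (V W : normedModType R) (f : V -> W)
    (x v w : V) : 'D_w (fun y => f (y + v)) x = 'D_w f (x + v).
Proof. by rewrite /derive; under eq_fun do rewrite /= -addrA. Qed.

Lemma differentiable_linear_comp (R : realType) (V : normedModType R) n n'
    (Q : {linear 'rV[R]_n -> 'rV[R]_n'}) (f : V -> 'rV[R]_n) (x : V) :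
  differentiable f x -> differentiable (fun y => Q (f y)) x.
Proof.
move=> df; apply: (@differentiable_comp _ _ _ _ f Q) => //.
exact/linear_differentiable/linear_mx_continuous.
Qed.

Lemma derive_linear_comp (R : realType) (V : normedModType R) n n'
    (Q : {linear 'rV[R]_n -> 'rV[R]_n'}) (f : V -> 'rV[R]_n) (x w : V) :
  differentiable f x -> 'D_w (fun y => Q (f y)) x = Q ('D_w f x).
Proof.
move=> df; have cQ := @linear_mx_continuous _ _ _ _ Q.
rewrite !deriveE //; last exact: differentiable_linear_comp.
rewrite (@diff_comp _ _ _ _ f Q) //; last exact: linear_differentiable.
by rewrite diff_lin.
Qed.

Lemma differentiable_row_entry (R : realType) (V : normedModType R) n
    (f : V -> 'rV[R]_n) (m : 'I_n) (x : V) :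
  differentiable f x -> differentiable (fun y => f y 0 m) x.
Proof.
move=> df; apply: (@differentiable_comp _ _ _ _ f (fun a => a 0 m)) => //.
exact: differentiable_coord.
Qed.

Lemma derive_row_entry (R : realType) (V : normedModType R) n
    (f : V -> 'rV[R]_n) (m : 'I_n) (x w : V) :
  differentiable f x -> 'D_w (fun y => f y 0 m) x = 'D_w f x 0 m.
Proof. by move=> /(diff_derivable (v := w))/derive_mx ->; rewrite mxE. Qed.

Lemma row_entry_le (R : realType) n (a : 'rV[R]_n) (m : 'I_n) :
  `|a 0 m| <= `|a|.
Proof.
by rewrite [leRHS]/Num.Def.normr/= mx_normrE (le_bigmax _ _ (0, m)).
Qed.

(** * The commutator relation for increments of the derivative *)

Section commutator.
Context {R : realType} {V : normedModType R} {n : nat}.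
Variables (f : V -> 'rV[R]_n) (c : V) (r : R).
Hypothesis df : forall y, ball c r y -> differentiable f y.

(** The averaged map has derivative [Q1 (A y)] along [u] and [Q2 (A y)] along [w], where [A y] is
    the increment of [f] over [v]. Both are differentiable again, so [derive_swap] applies;
    differentiating [A] along [w] or [u] brings out the other operator. *)
Lemma derive_commutator (Q1 Q2 : {linear 'rV[R]_n -> 'rV[R]_n})
    (v u w x : V) :
  (forall y, ball c r y -> 'D_u f y = Q1 ('D_v f y)) ->
  (forall y, ball c r y -> 'D_w f y = Q2 ('D_v f y)) ->
  (forall z y, ball c r y -> {for y, continuous ('D_z f)}) ->
  (forall z, exists M, forall y, ball c r y -> `|'D_z f y| <= M) ->
  ball c r x -> ball c r (x + v) ->
  Q1 (Q2 ('D_v f (x + v) - 'D_v f x)) = Q2 (Q1 ('D_v f (x + v) - 'D_v f x)).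
Proof.
move=> fu fw cf bf xB xvB.
pose A y := f (y + v) - f y.
have dA y : ball c r y -> ball c r (y + v) -> differentiable A y.
  move=> yB yvB; apply: differentiableB; last exact: df.
  exact/differentiable_shift/df.
have DA z y : ball c r y -> ball c r (y + v) ->
    'D_z A y = 'D_z f (y + v) - 'D_z f y.
  move=> yB yvB; rewrite deriveB ?derive_shiftr//.
  - exact/diff_derivable/differentiable_shift/df.
  - exact/diff_derivable/df.
have nearB : \forall y \near x, ball c r y /\ ball c r (y + v).
  apply: filterI; first exact: (open_nbhs_nbhs (conj (ball_open _ _) _)).
  have : (fun y => y + v) y @[y --> x] --> x + v.
    by apply: cvgD; [exact: cvg_id|exact: cvg_cst].
  by apply; exact: (open_nbhs_nbhs (conj (ball_open _ _) _)).
apply/rowP => m.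
pose F y := \int[@lebesgue_measure R]_(t in `[0, 1]) f (y + t *: v) 0 m.
(* Used for [u] with [Q1] and for [w] with [Q2]; here [psi] is a coordinate of [Q (f y)], as [Q]
   commutes with ['D_v]. *)
have dF (z : V) (Q : {linear 'rV[R]_n -> 'rV[R]_n}) :
    (forall y, ball c r y -> 'D_z f y = Q ('D_v f y)) ->
    \forall y \near x, is_derive y z F (Q (A y) 0 m).
  move=> fz; have [N fN] := bf z.
  near=> y.
  have [yB yvB] : ball c r y /\ ball c r (y + v) by near: y.
  rewrite /A linearB mxE [X in _ + X]mxE.
  apply: (@is_derive_segment_integral _ _ (fun y => f y 0 m)
    (fun y => Q (f y) 0 m) c r N) => //.
  - by move=> a aB; exact/differentiable_row_entry/df.
  - move=> a aB.
    exact/differentiable_row_entry/differentiable_linear_comp/df.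
  - move=> a aB; rewrite !derive_row_entry ?derive_linear_comp ?fz//; 
      [exact: df|apply: differentiable_linear_comp|]; exact: df.
  - move=> a aB.
    (* The coordinate of the derivative is known to be the derivative of the coordinate only inside
       the ball, so continuity is transferred by equality near [a]. *)
    have : {near a, (fun b => 'D_z f b 0 m) =1 'D_z (fun b => f b 0 m)}.
      near=> b; rewrite derive_row_entry //; apply: df; near: b.
      exact: (open_nbhs_nbhs (conj (ball_open _ _) _)).
    move/near_eq_cvg; rewrite /continuous_at => /cvg_trans; apply.
    rewrite derive_row_entry; last exact: df.
    apply: (@continuous_comp _ _ _ ('D_z f) (fun a => a 0 m)); first exact: cf.
    exact: coord_continuous.
  - move=> a aB; rewrite derive_row_entry; last exact: df.
    exact: le_trans (row_entry_le _ _) (fN _ aB).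
have DQA z (Q : {linear 'rV[R]_n -> 'rV[R]_n}) :
    'D_z (fun y => Q (A y) 0 m) x = Q ('D_z f (x + v) - 'D_z f x) 0 m.
  have dAx := dA _ xB xvB.
  rewrite derive_row_entry; last exact: differentiable_linear_comp.
  by rewrite derive_linear_comp // DA.
have := derive_swap (dF _ _ fu) (dF _ _ fw).
rewrite !DQA !fu // !fw // -!linearB.
by apply; apply/differentiable_row_entry/differentiable_linear_comp/dA.
Unshelve. all: by end_near. Qed.

End commutator.

(** * From constant derivatives to affine maps, on balls and then globally *)

Section local_affine.
Context {R : realType} {V : normedModType R} {n : nat}.
Variables (f : V -> 'rV[R]_n) (c : V) (r : R).
Hypothesis df : forall y, ball c r y -> differentiable f y.

(** Along the segment from [x] to [y] each coordinate of [f] has constant derivative, so the mean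
    value theorem gives its exact increment. *)
Lemma affine_on_ball :
  (forall x v, ball c r x -> ball c r (x + v) -> 'D_v f (x + v) = 'D_v f x) ->
  forall x y, ball c r x -> ball c r y -> f y = f x + 'd f x (y - x).
Proof.
move=> fE x y xB yB; pose v := y - x.
have xvB : ball c r (x + v) by rewrite /v subrKC.
have Dv (s : R) : s \in `[0, 1] -> 'D_v f (x + s *: v) = 'D_v f x.
  rewrite in_itv /= => s01.
  have [->|s0] := eqVneq s 0; first by rewrite scale0r addr0.
  have sB := ball_segment xB xvB s01.
  (* The hypothesis ties the direction to the displacement, here both [s *: v]; linearity of the
     differential lets the nonzero factor [s] cancel. *)
  have := fE _ _ xB sB; rewrite !deriveE; try exact: df.
  by rewrite !linearZ => /(scalerI s0).
rewrite -deriveE; last exact: df.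
apply/rowP => m; rewrite mxE -[f y 0 m](subrK (f x 0 m)) addrC; congr (_ + _).
pose g (s : R) := f (x + s *: v) 0 m.
have dg (s : R) : s \in `[0, 1] -> is_derive s 1 g ('D_v f x 0 m).
  move=> s01; have sB : ball c r (x + s *: v) by exact: ball_segment.
  rewrite -(Dv _ s01) -derive_row_entry; last exact: df.
  apply/(is_derive_lineP (fun y => f y 0 m))/derivableP/diff_derivable.
  exact/differentiable_row_entry/df.
have cg : {within `[0, 1], continuous g}.
  apply: derivable_within_continuous => s s01.
  by have [] := dg _ s01.
have dg' (s : R) : s \in `]0, 1[ -> is_derive s 1 g ('D_v f x 0 m).
  by move=> /subset_itv_oo_cc; exact: dg.
have [s _] := MVT ltr01 dg' cg.
by rewrite /g scale1r scale0r addr0 subr0 mulr1 /v subrKC => ->.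
Qed.
End local_affine.

Lemma affine_near_inj (R : realType) (V W : normedModType R)
    (A A' : {linear V -> W}) (b b' : W) (x : V) :
  (\forall y \near x, A y + b = A' y + b') -> A =1 A' /\ b = b'.
Proof.
move=> /nbhs_interior AA'.
have Ax : A x + b = A' x + b' by exact: nbhs_singleton (nbhs_singleton AA').
have AE : A =1 A'.
  move=> w.
  (* For small [s > 0] the equality also holds at [x + s *: w]; subtracting the one at [x] leaves
     [s *: A w = s *: A' w]. *)
  near (0 : R)^'+ => s.
  have s0 : s != 0 by rewrite gt_eqF.
  have /interior_subset/= : ((fun y => A y + b = A' y + b')^°) (x + s *: w).
    near: s; apply: cvg_within; apply: near_line; first exact: open_interior.
    exact: nbhs_singleton AA'.
  rewrite !linearD addrAC Ax addrAC => /addIr/addrI; rewrite !linearZ.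
  exact: scalerI.
by split => //; move: Ax; rewrite AE => /addrI.
Unshelve. all: by end_near. Qed.

(** Fix the affine form of [f] near one point. The points of [Omega] near which [f] has this same
    form make up a nonempty subset, open and closed in [Omega]. *)
Lemma connected_locally_affine (R : realType) (V W : normedModType R)
    (Omega : set V) (f : V -> W) : connected Omega ->
  (forall x, Omega x -> exists (A : {linear V -> W}) (b : W),
    \forall y \near x, f y = A y + b) ->
  exists (A : {linear V -> W}) (b : W), forall x, Omega x -> f x = A x + b.
Proof.
move=> cO fA.
have [[x0 Ox0]|/forallNP O0] := pselect (Omega !=set0); last first.
  by exists \0, 0 => x /O0.
have [A [b fx0]] := fA _ Ox0; exists A, b.
pose E := [set y | f y = A y + b].
suff : Omega `&` E^° = Omega.
  by move=> OE x; rewrite -OE => -[_ /interior_subset].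
apply: cO.
- by exists x0; split.
- by exists E^° => //; exact: open_interior.
- exists (closure (Omega `&` E^°)); first exact: closed_closure.
  apply/seteqP; split=> [x xOE|x [Ox clx]].
    by split; [case: xOE|exact: subset_closure].
  split => //.
  (* Closedness: the affine form at the limit point [x] is valid near some [y] of the set, where it
     must coincide with [A] and [b]. *)
  have [A' [b' fx]] := fA _ Ox.
  have [y [[_ yE] yfx]] := clx _ (nbhs_interior fx).
  have [AA' bb'] : A =1 A' /\ b = b'.
    apply: (@affine_near_inj _ _ _ A A' b b' y).
    by apply: filterS2 yE yfx => z /= <- <-.
  by apply: filterS fx => z; rewrite /E /= AA' bb'.
Qed.

(** * Quaternion algebra *)

Lemma qmulA (R : realType) (x y z : quat R) :
  qmul x (qmul y z) = qmul (qmul x y) z.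
Proof.
by apply/rowP => -[[|[|[|[|m]]]] hm] //; rewrite /qmul /mkquat !mxE /=; ring.
Qed.

Lemma qmul_is_linear (R : realType) (p : quat R) : linear (qmul p).
Proof.
move=> a x y.
by apply/rowP => -[[|[|[|[|m]]]] hm] //; rewrite /qmul /mkquat !mxE /=; ring.
Qed.

HB.instance Definition _ (R : realType) (p : quat R) :=
  GRing.isLinear.Build R (quat R) (quat R) *:%R (qmul p) (qmul_is_linear p).

Lemma quatP (R : realType) (x y : quat R) :
  x 0 0 = y 0 0 -> x 0 1 = y 0 1 -> x 0 2 = y 0 2 -> x 0 3 = y 0 3 -> x = y.
Proof.
move=> h0 h1 h2 h3; apply/rowP => -[[|[|[|[|m]]]] hm] //;
  [move: h0|move: h1|move: h2|move: h3];
  by congr (x _ _ = y _ _); exact/val_inj.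
Qed.

Lemma qmulNone (R : realType) (x : quat R) : qmul (- qone R) x = - x.
Proof. by apply: quatP; rewrite /qmul /qone /mkquat !mxE /=; ring. Qed.

Lemma sphere2P (R : realType) (p : quat R) : sphere2 p ->
  p 0 0 = 0 /\ p 0 1 ^+ 2 + p 0 2 ^+ 2 + p 0 3 ^+ 2 = 1.
Proof.
move=> /rowP pp.
have := pp 0; have := pp 1; have := pp 2; have := pp 3.
rewrite /qmul /qone /mkquat !mxE /= => h3 h2 h1 h0.
(* The imaginary parts of [qmul p p] are [2 * p 0 0 * p 0 m]. If [p 0 0] were nonzero, [p] would be
   real with square -1. *)
have p00 : p 0 0 = 0.
  apply/eqP/negP => /negP p0.
  have {}h1 : p 0 1 = 0 by apply: (mulfI p0); lra.
  have {}h2 : p 0 2 = 0 by apply: (mulfI p0); lra.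
  have {}h3 : p 0 3 = 0 by apply: (mulfI p0); lra.
  move: h0; rewrite h1 h2 h3; nra.
split=> //.
move: h0; rewrite p00; lra.
Qed.

(** For imaginary [p] and [p'] the commutator is twice their cross product, which vanishes for unit
    vectors only when they are equal or opposite; a nonzero quaternion is invertible. *)
Lemma qmul_commutator_inj (R : realType) (p p' a : quat R) :
  sphere2 p -> sphere2 p' -> p <> p' -> p <> - p' ->
  qmul p (qmul p' a) = qmul p' (qmul p a) -> a = 0.
Proof.
move=> /sphere2P[p0 pn] /sphere2P[p0' pn'] pp' pNp' comm.
pose c1 := p 0 2 * p' 0 3 - p 0 3 * p' 0 2.
pose c2 := p 0 3 * p' 0 1 - p 0 1 * p' 0 3.
pose c3 := p 0 1 * p' 0 2 - p 0 2 * p' 0 1.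
(* [(c1, c2, c3)] is the cross product [c] of [p] and [p'], and
   [|c|^2 + <p, p'>^2 = 1]. *)
have c_neq0 : c1 ^+ 2 + c2 ^+ 2 + c3 ^+ 2 != 0.
  apply/eqP => c0.
  pose s := p 0 1 * p' 0 1 + p 0 2 * p' 0 2 + p 0 3 * p' 0 3.
  have s1 : (s - 1) * (s + 1) = 0.
    have : c1 ^+ 2 + c2 ^+ 2 + c3 ^+ 2 + s ^+ 2 =
      (p 0 1 ^+ 2 + p 0 2 ^+ 2 + p 0 3 ^+ 2) *
      (p' 0 1 ^+ 2 + p' 0 2 ^+ 2 + p' 0 3 ^+ 2) by rewrite /c1 /c2 /c3 /s; ring.
    by rewrite c0 pn pn' add0r mul1r -subr_sqr_1 => ->; rewrite subrr.
  (* The squared distance from [p] to [e *: p'] is [1 + e ^+ 2 - 2 * e * s], which is 0 here. *)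
  have dist (e : R) : e ^+ 2 = 1 -> s = e -> p = e *: p'.
    move=> e1 se.
    have : (p 0 1 - e * p' 0 1) ^+ 2 + (p 0 2 - e * p' 0 2) ^+ 2 +
        (p 0 3 - e * p' 0 3) ^+ 2 = 0.
      transitivity (p 0 1 ^+ 2 + p 0 2 ^+ 2 + p 0 3 ^+ 2 +
        e ^+ 2 * (p' 0 1 ^+ 2 + p' 0 2 ^+ 2 + p' 0 3 ^+ 2) - 2 * e * s).
        by rewrite /s; ring.
      by rewrite pn pn' se mulr1 e1 -mulrA -expr2 e1 mulr1 subrr.
    move/eqP; rewrite !paddr_eq0 ?addr_ge0 ?sqr_ge0// !sqrf_eq0 !subr_eq0.
    move=> /andP[/andP[/eqP h1 /eqP h2] /eqP h3].
    by apply: quatP; rewrite mxE // p0 p0' mulr0.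
  move/eqP: s1; rewrite mulf_eq0 subr_eq0 addr_eq0 => /orP[] /eqP se.
    by apply: pp'; rewrite (dist 1) ?scale1r// expr1n.
  by apply: pNp'; rewrite (dist (-1)) ?scaleN1r// sqrrN expr1n.
have := comm => /rowP E.
have := E 0; have := E 1; have := E 2; have := E 3.
rewrite /qmul /mkquat !mxE /= p0 p0' => h3 h2 h1 h0.
have e0 : - c1 * a 0 1 - c2 * a 0 2 - c3 * a 0 3 = 0
  by rewrite /c1 /c2 /c3; lra.
have e1 : c1 * a 0 0 + c2 * a 0 3 - c3 * a 0 2 = 0
  by rewrite /c1 /c2 /c3; lra.
have e2 : c2 * a 0 0 + c3 * a 0 1 - c1 * a 0 3 = 0
  by rewrite /c1 /c2 /c3; lra.
have e3 : c3 * a 0 0 + c1 * a 0 2 - c2 * a 0 1 = 0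
  by rewrite /c1 /c2 /c3; lra.
clear h0 h1 h2 h3 E comm.
clearbody c1 c2 c3.
(* [e0]-[e3] say [c a = 0]; multiply on the left by the conjugate of [c]. *)
apply: quatP; rewrite mxE; apply: (mulfI c_neq0); rewrite mulr0.
- transitivity (c1 * (c1 * a 0 0 + c2 * a 0 3 - c3 * a 0 2) +
    c2 * (c2 * a 0 0 + c3 * a 0 1 - c1 * a 0 3) +
    c3 * (c3 * a 0 0 + c1 * a 0 2 - c2 * a 0 1)); first by ring.
  by rewrite e1 e2 e3 !mulr0 !addr0.
- transitivity (- c1 * (- c1 * a 0 1 - c2 * a 0 2 - c3 * a 0 3) +
    c3 * (c2 * a 0 0 + c3 * a 0 1 - c1 * a 0 3) -
    c2 * (c3 * a 0 0 + c1 * a 0 2 - c2 * a 0 1)); first by ring.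
  by rewrite e0 e2 e3 !mulr0 subr0 addr0.
- transitivity (- c2 * (- c1 * a 0 1 - c2 * a 0 2 - c3 * a 0 3) -
    c3 * (c1 * a 0 0 + c2 * a 0 3 - c3 * a 0 2) +
    c1 * (c3 * a 0 0 + c1 * a 0 2 - c2 * a 0 1)); first by ring.
  by rewrite e0 e1 e3 !mulr0 subr0 addr0.
- transitivity (- c3 * (- c1 * a 0 1 - c2 * a 0 2 - c3 * a 0 3) +
    c2 * (c1 * a 0 0 + c2 * a 0 3 - c3 * a 0 2) -
    c1 * (c2 * a 0 0 + c3 * a 0 1 - c1 * a 0 3)); first by ring.
  by rewrite e0 e1 e2 !mulr0 subr0 addr0.
Qed.

(** * Holomorphic maps and the conclusion *)

(** Multiply the holomorphy equation on the left by [p] and use that [p] squares to -1. *)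
Lemma Hol_derive (R : realType) (p : quat R) (Omega : set (quat R)) f x v :
  sphere2 p -> Hol p Omega f -> Omega x ->
  'D_(Jp p v) f x = qmul p ('D_v f x).
Proof.
move=> pS [C1f fp] Ox; have [dfx _] := C1f _ Ox.
rewrite !deriveE //; have /(congr1 (qmul p)) := fp _ Ox v.
rewrite linearD linear0 /= qmulA pS qmulNone => /eqP; rewrite subr_eq0.
by move=> /eqP.
Qed.

(** On [Omega], ['D_z f y] is [z *m jacobian f y], so continuity and local boundedness of the
    Jacobian pass to every directional derivative. *)
Lemma C1_on_ball (R : realType) (Omega : set (quat R)) (f : quat R -> quat R)
    (x : quat R) : open Omega -> C1_on Omega f -> Omega x ->
  exists2 r : R, 0 < r & [/\ ball x r `<=` Omega,
    (forall z y, ball x r y -> {for y, continuous ('D_z f)}) &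
    (forall z, exists M, forall y, ball x r y -> `|'D_z f y| <= M)].
Proof.
move=> oO C1f Ox.
have DE z y : Omega y -> 'D_z f y = z *m jacobian f y.
  by move=> /C1f[dfy _]; rewrite deriveEjacobian.
have mulz_cont (z : quat R) := @linear_mx_continuous R _ _ _
  (mulmx z : 'M[R]_4 -> quat R).
have : \forall y \near x, Omega y /\ `|jacobian f y| <= `|jacobian f x| + 1.
  apply: filterI; first exact: (open_nbhs_nbhs (conj oO Ox)).
  have /cvgrPdist_le/(_ _ ltr01) := (C1f _ Ox).2; apply: filterS => y.
  rewrite -lerBlDl => /(le_trans _); apply.
  by rewrite distrC (lerB_dist).
move=> /nbhs_ballP[r /= r0 rO]; exists r => //; split.
- by move=> y /rO[].
- move=> z y /rO[Oy _].
  have : {near y, (fun a => z *m jacobian f a) =1 'D_z f}.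
    near=> a; rewrite DE //; near: a; exact: (open_nbhs_nbhs (conj oO Oy)).
  move/near_eq_cvg; rewrite /continuous_at => /cvg_trans; apply.
  rewrite DE //.
  exact: (continuous_comp (C1f _ Oy).2 (mulz_cont z (jacobian f y))).
- move=> z; have [k k0 kle] := linear_lipschitz (mulz_cont z).
  exists (k * (`|jacobian f x| + 1)) => y /rO[Oy Jy]; rewrite DE //.
  by rewrite (le_trans (kle _))// ler_wpM2l// ltW.
Unshelve. all: by end_near. Qed.

Unset Implicit Arguments.

Theorem mainTheorem3 (R : realType) (Omega : set (quat R)) (p p' : quat R)
    (f : quat R -> quat R) :
  open Omega -> connected Omega -> bounded_set Omega ->
  sphere2 p -> sphere2 p' -> p <> p' -> p <> - p' ->
  (Hol p Omega `&` Hol p' Omega) f ->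
  affine_on Omega f.
Proof.
move=> oO cO _ pS p'S pp' pNp' [fp fp'].
have C1f := fp.1.
apply: connected_locally_affine => // x0 Ox0.
have [r r0 [rO cf bf]] := C1_on_ball oO C1f Ox0.
have df y : ball x0 r y -> differentiable f y by move=> /rO/C1f[].
have x0B : ball x0 r x0 by exact: ballxx.
(* This is the first-order Taylor polynomial of [f] at the centre [x0]. *)
exists ('d f x0), (f x0 - 'd f x0 x0).
apply/nbhs_ballP; exists r => //= y yB.
rewrite addrCA -linearB; apply: (affine_on_ball df) => // x v xB xvB.
(* The increment of ['D_v f] vanishes once left multiplications by [p] and [p'] commute on it; the
   directions [Jp p v] and [Jp p' v] provide this. *)
apply: subr0_eq; apply: (qmul_commutator_inj pS p'S pp' pNp').
apply: (derive_commutator df (u := Jp p v) (w := Jp p' v)) => // z /rO Oz.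
  exact: (Hol_derive _ pS fp).
exact: (Hol_derive _ p'S fp').
Qed.
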